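(* Let $N\ge 2$ be a natural number. (a) $N\in\Lambda_{2n}$ for some $n\ge0$ if and only if $\beta(N)$, with the radix point removed, ends in $10^s1$ with $s$ odd; and $N\in\Lambda_{2n+1}$ for some $n\ge 0$ if and only if $\beta(N)$, with the radix point removed, ends in $10^s1$ with $s$ even. (b) Write $\beta(N)=d_{L(N)}\dots d_{R(N)}$. If $N\in\Lambda_{2n}$ then $-R(N)=2n$, and if $N\in\Lambda_{2n+1}$ then $-R(N)=2n+2$.
   Context: $(L_n)_{n\ge0}$ are the Lucas numbers: $L_0=2$, $L_1=1$, $L_{n+1}=L_n+L_{n-1}$ for $n\ge1$. The even and odd Lucas intervals are the integer intervals $\Lambda_{2n}=[L_{2n},\,L_{2n+1}]$ and $\Lambda_{2n+1}=[L_{2n+1}+1,\,L_{2n+2}-1]$, for $n\ge0$ (so $\Lambda_0=\emptyset$ and $\Lambda_1=\{2\}$). Let $\varphi=(1+\sqrt5)/2$. The Bergman expansion $\beta(N)$ of a natural number $N$ is the unique sequence $(d_i)_{i\in\mathbb Z}$ with $d_i\in\{0,1\}$, only finitely many $d_i$ nonzero, $N=\sum_i d_i\varphi^i$, and $d_{i+1}d_i=11$ never occurring; it is written $d_{L(N)}\dots d_0\cdot d_{-1}\dots d_{R(N)}$, where $L(N)$ and $R(N)$ are the largest and the smallest index $i$ with $d_i=1$. Here $0^s$ denotes a block of $s$ zeros. *)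

(* Defs.v *)
From mathcomp Require Import all_boot all_order all_algebra.
From mathcomp Require Import all_classical all_reals.

Set Implicit Arguments.
Unset Strict Implicit.
Unset Printing Implicit Defensive.

Import Order.TTheory GRing.Theory Num.Theory.

Local Open Scope ring_scope.

Fixpoint lucas (n : nat) : nat :=
  match n with
  | 0 => 2
  | 1 => 1
  | (m.+1 as k).+1 => (lucas k + lucas m)%N
  end.

Definition even_lucas_interval (n : nat) : pred nat :=
  [pred N | (lucas (2 * n) <= N <= lucas (2 * n + 1))%N].

(* The truncated subtraction is harmless since lucas (2 * n + 2) >= 3. *)
Definition odd_lucas_interval (n : nat) : pred nat :=
  [pred N | (lucas (2 * n + 1) + 1 <= N <= lucas (2 * n + 2) - 1)%N].

Definition phi (R : realType) : R := (1 + Num.sqrt 5) / 2.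

(* [d] is the Bergman expansion of [N]; the digits 1 and 0 are encoded as
   [true] and [false]. *)
Definition is_bergman (R : realType) (N : nat) (d : int -> bool) : Prop :=
  [/\ finite_set [set i : int | d i]%classic,
      forall i : int, ~~ (d (i + 1) && d i)
    & N%:R = \sum_(i \in [set: int]%classic) (d i)%:R * phi R ^ i].

Definition is_largest_index (d : int -> bool) (l : int) : Prop :=
  d l /\ forall i : int, d i -> i <= l.

Definition is_smallest_index (d : int -> bool) (r : int) : Prop :=
  d r /\ forall i : int, d i -> r <= i.

(* The word d_l d_(l-1) ... d_r without radix point, most significant digit
   first; meant for r <= l. *)
Definition digit_word (d : int -> bool) (l r : int) : seq bool :=
  [seq d (l - k%:Z) | k <- iota 0 `|l - r|%N.+1].

(* The word 1 0^s 1. *)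
Definition one_zeros_one (s : nat) : seq bool :=
  true :: rcons (nseq s false) true.

(* Main.v *)
Require Import Defs.
From mathcomp Require Import all_boot all_order all_algebra.
From mathcomp Require Import all_classical all_reals.
From mathcomp Require Import zify ring lra.

Import Order.TTheory GRing.Theory Num.Theory.

Local Open Scope ring_scope.

(** Let [r = -m] be the index of the lowest digit of [N], and let the golden
    ratio be [t], so that its algebraic conjugate is [1 - t = - 1 / t].

    Conjugation turns the lowest digit into the dominant one.  Since [t] is
    irrational, the identity [N = sum_i d_i t ^ i] remains true when [t] is
    replaced by [1 - t] ([word_value_galois]); reading the digits upwards from
    [r], it says [N = (- t) ^ m * v] with [v = sum_k d_(r + k) (1 - t) ^ k].
    As no two consecutive digits are 1 and the lowest one is, summing geometric
    series gives [t - 1 < v < t] ([conj_value_bounds]).  Positivity of [N]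
    forces [m] to be even, [N >= 2] forces [m > 0], and thus
    [t ^ (m - 1) < N < t ^ (m + 1)] with [m = 2p + 2].

    The second lowest digit 1, at distance [s + 1] from the lowest one,
    contributes to [v - 1] a term with the sign of [(- 1) ^ (s + 1)] that
    outweighs all the following ones: [v > 1] if [s] is odd, [v < 1] if [s] is
    even ([conj_value_first_gap]).  Hence the parity of [s] tells on which side
    of [t ^ m] the number [N] lies.

    Finally [L_k = t ^ k + (1 - t) ^ k] differs from [t ^ k] by less than 1, so
    that comparing the integer [N] with [t ^ k] for [k = m - 1, m, m + 1] is
    comparing it with [L_k] ([bergman_gap]): [N] lies in [Lambda_m] or in
    [Lambda_(m - 1)] according to the parity of [s].  As these intervals are
    pairwise disjoint, this one statement contains all four claims. *)

Local Arguments lucas : simpl never.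

(** * Arithmetic of the golden ratio *)

(** The exponent of 5 would be even on one side and odd on the other. *)
Lemma five_nonsquare (u v : int) : u ^+ 2 = 5 * v ^+ 2 -> v = 0.
Proof.
move=> uv; apply/eqP; case: (eqVneq v 0) => // v0.
have : (`|u| ^ 2 = 5 * `|v| ^ 2)%N by rewrite -!abszX uv abszM.
have v_gt0 : (0 < `|v|)%N by rewrite absz_gt0.
move/(congr1 (logn 5)).
by rewrite lognM ?expn_gt0 ?v_gt0// !lognX (_ : logn 5 5 = 1%N)//; lia.
Qed.

(** Otherwise completing the square in [t ^ 2 = t + 1] would make 5 the square
    of a rational number. *)
Lemma golden_irrational {R : realFieldType} {t : R} (a b c : int) :
  t ^+ 2 = t + 1 -> c%:~R = a%:~R + b%:~R * t -> b = 0.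
Proof.
(* [2 * (c - a) - b] is [b * (2 t - 1)], and [(2 t - 1) ^ 2 = 5]. *)
move=> ht hc; apply: (@five_nonsquare (2 * (c - a) - b)).
apply: (@intr_inj R); rewrite !(rmorphXn, rmorphB, rmorphM) /= hc.
have -> : (5 : int)%:~R = 5 :> R by [].
have -> : (2 : int)%:~R = 2 :> R by [].
have -> : (2 * (a%:~R + b%:~R * t - a%:~R) - b%:~R) ^+ 2 =
  b%:~R ^+ 2 * (4 * t ^+ 2 - 4 * t + 1) :> R by ring.
by rewrite ht; ring.
Qed.

Lemma phi_sqr (R : realType) : phi R ^+ 2 = phi R + 1.
Proof.
have h5 : Num.sqrt (5 : R) ^+ 2 = 5 by rewrite sqr_sqrtr.
rewrite /phi; move: (Num.sqrt _) h5 => x h5.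
have -> : ((1 + x) / 2) ^+ 2 = (1 + 2 * x + x ^+ 2) / 4 by field.
by rewrite h5; field.
Qed.

Lemma phi_gt1 (R : realType) : 1 < phi R.
Proof.
have : 1 < Num.sqrt (5 : R) by rewrite -[X in X < _]sqrtr1 ltr_sqrt; lra.
by rewrite /phi; lra.
Qed.

Lemma golden_lt2 {R : realFieldType} {t : R} :
  t ^+ 2 = t + 1 -> 1 < t -> t < 2.
Proof. by rewrite expr2 => ht t1; nra. Qed.

(** * Lucas numbers *)

Lemma lucas_binet {R : realFieldType} {t : R} (n : nat) :
  t ^+ 2 = t + 1 -> (lucas n)%:R = t ^+ n + (1 - t) ^+ n.
Proof.
move=> ht.
have ht' : (1 - t) ^+ 2 = (1 - t) + 1.
  by rewrite (_ : (1 - t) ^+ 2 = 1 - 2 * t + t ^+ 2); [rewrite ht|]; ring.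
have step x k : x ^+ 2 = x + 1 -> x ^+ k.+2 = x ^+ k.+1 + x ^+ k :> R.
  by move=> hx; rewrite -addn2 exprD hx exprSr; ring.
have: (lucas n)%:R = t ^+ n + (1 - t) ^+ n /\
      (lucas n.+1)%:R = t ^+ n.+1 + (1 - t) ^+ n.+1.
  elim: n => [|n [IH1 IH2]]; first by rewrite /lucas !expr0 !expr1; split; ring.
  split=> //; rewrite (_ : lucas n.+2 = lucas n.+1 + lucas n)%N// natrD IH1 IH2.
  by rewrite [t ^+ n.+2]step// [(1 - t) ^+ n.+2]step//; ring.
by case.
Qed.

Lemma lucas_gt0 (n : nat) : (0 < lucas n)%N.
Proof.
suff /andP[] : (0 < lucas n)%N && (0 < lucas n.+1)%N by [].
elim: n => // n /andP[L0 L1]; rewrite L1 /=.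
by rewrite (_ : lucas n.+2 = lucas n.+1 + lucas n)%N// addn_gt0 L1.
Qed.

Lemma ltn_lucasS (n : nat) : (0 < n)%N -> (lucas n < lucas n.+1)%N.
Proof.
case: n => // n _; rewrite (_ : lucas n.+2 = lucas n.+1 + lucas n)%N//.
by rewrite -addn1 leq_add2l lucas_gt0.
Qed.

Lemma leq_lucas (i j : nat) : (0 < i)%N -> (i <= j)%N -> (lucas i <= lucas j)%N.
Proof.
move=> i_gt0 /subnK <-; elim: (j - i)%N => // k IH; apply: (leq_trans IH).
by rewrite addSn ltnW// ltn_lucasS// addn_gt0 i_gt0 orbT.
Qed.

(** For odd [k], [L_k = t ^ k - (t - 1) ^ k] lies below [t ^ k], at distance less
    than 1, so that no integer lies strictly between the two. *)
Lemma lucas_odd_bounds {R : realFieldType} {t : R} (p N : nat) :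
  t ^+ 2 = t + 1 -> 1 < t ->
  (t ^+ (2 * p).+1 < N%:R -> (lucas (2 * p).+1 < N)%N) /\
  (N%:R < t ^+ (2 * p).+1 -> (N <= lucas (2 * p).+1)%N).
Proof.
move=> ht t1; have t2 := golden_lt2 ht t1.
have q1 : 0 < (t - 1) ^+ (2 * p).+1 < 1.
  by rewrite exprn_gt0 ?exprn_ilt1//=; lra.
have hL := lucas_binet (2 * p).+1 ht; move: hL.
rewrite -[1 - t]opprB exprNn -signr_odd /= oddM /= expr1 => hL.
split=> hN; [rewrite -(@ltr_nat R)|rewrite -ltnS -(@ltr_nat R) mulrS]; lra.
Qed.

(** The even counterpart: [L_k] now lies just above [t ^ k].  The exponent starts
    at 2 because [L_0 = t ^ 0 + 1] is at distance exactly 1. *)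
Lemma lucas_even_bounds {R : realFieldType} {t : R} (p N : nat) :
  t ^+ 2 = t + 1 -> 1 < t ->
  (t ^+ (2 * p).+2 < N%:R -> (lucas (2 * p).+2 <= N)%N) /\
  (N%:R < t ^+ (2 * p).+2 -> (N < lucas (2 * p).+2)%N).
Proof.
move=> ht t1; have t2 := golden_lt2 ht t1.
have q1 : 0 < (t - 1) ^+ (2 * p).+2 < 1.
  by rewrite exprn_gt0 ?exprn_ilt1//=; lra.
have hL := lucas_binet (2 * p).+2 ht; move: hL.
rewrite -[1 - t]opprB exprNn -signr_odd /= oddM /= expr0 => hL.
split=> hN; [rewrite -ltnS -(@ltr_nat R) mulrS|rewrite -(@ltr_nat R)]; lra.
Qed.

(** The hypothesis places [N] in the union of [Lambda_(2p+1)] and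
    [Lambda_(2p+2)]; the consecutive Lucas intervals being disjoint, [N] can
    lie in no other one, and [L_(2p+2)] separates these two. *)
Lemma even_lucas_intervalE (p n N : nat) :
  (lucas (2 * p).+1 < N <= lucas (2 * p).+3)%N ->
  (N \in even_lucas_interval n) = (n == p.+1) && (lucas (2 * p).+2 <= N)%N.
Proof.
move=> /andP[lo hi]; rewrite inE /=.
case: (ltngtP n p.+1) => [np|pn|->] /=.
- apply/negP => /andP[_]; have := @leq_lucas (2 * n + 1) (2 * p).+1; lia.
- apply/negP => /andP[+ _]; have := @leq_lucas (2 * p).+4 (2 * n).
  by have := ltn_lucasS (2 * p).+3 isT; lia.
- rewrite (_ : 2 * p.+1 = (2 * p).+2)%N ?addn1; last by lia.
  by rewrite hi andbT.
Qed.

Lemma odd_lucas_intervalE (p n N : nat) :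
  (lucas (2 * p).+1 < N <= lucas (2 * p).+3)%N ->
  (N \in odd_lucas_interval n) = (n == p) && (N < lucas (2 * p).+2)%N.
Proof.
move=> /andP[lo hi]; rewrite inE /= !addn1 addn2.
have l0 := lucas_gt0 (2 * n).+2.
case: (ltngtP n p) => [np|pn|->] /=.
- apply/negP => /andP[_]; have := @leq_lucas (2 * n).+2 (2 * p).+1; lia.
- apply/negP => /andP[+ _]; have := @leq_lucas (2 * p).+3 (2 * n).+1; lia.
- by rewrite lo /=; have := lucas_gt0 (2 * p).+2; lia.
Qed.

(** * Conjugation of words of digits *)

(** Words are read from the least significant digit on, so that the value obeys
    the Horner recursion and the lowest digit is the head. *)
Definition word_value {R : pzRingType} (x : R) (w : seq bool) : R :=
  foldr (fun (b : bool) v => b%:R + x * v) 0 w.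

Definition sparse (w : seq bool) : bool := sorted (fun a b => ~~ (a && b)) w.

(** Over the integers, [x ^ r * word_value x w] reduces to [a + b x] modulo
    [x ^ 2 = x + 1], with the same [a] and [b] for both roots; irrationality of
    [t] forces [b = 0]. *)
Lemma word_value_galois {R : realFieldType} {t : R} (N : nat) (r : int)
    (w : seq bool) :
  t ^+ 2 = t + 1 ->
  N%:R = t ^ r * word_value t w -> N%:R = (1 - t) ^ r * word_value (1 - t) w.
Proof.
move=> ht hN.
have [a [b hab]] : exists a b : int, forall x : R, x ^+ 2 = x + 1 ->
    x ^ r * word_value x w = a%:~R + b%:~R * x.
  (* In the basis [1, x], multiplication by [x] maps [(a, b)] to [(b, a + b)]
     and multiplication by [x^-1 = x - 1] maps it to [(b - a, a)]. *)
  elim: r {hN} => [|n [a [b IH]]|n [a [b IH]]].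
  - elim: w => [|c w [a [b IH]]].
      by exists 0, 0 => x _; rewrite !mulr0z mul0r addr0 mulr0.
    exists (c%:Z + b), (a + b) => x hx; have := IH x hx.
    rewrite expr0z !mul1r /= => ->; rewrite !rmorphD /=.
    rewrite (_ : (c%:Z)%:~R = c%:R)//.
    have -> : x * (a%:~R + b%:~R * x) = a%:~R * x + b%:~R * x ^+ 2 by ring.
    by rewrite hx; ring.
  - exists b, (a + b) => x hx.
    rewrite exprSz -mulrA (IH x hx) rmorphD /=.
    have -> : x * (a%:~R + b%:~R * x) = a%:~R * x + b%:~R * x ^+ 2 by ring.
    by rewrite hx; ring.
  - exists (b - a), a => x hx.
    have x0 : x != 0.
      apply/eqP => x0; move: hx; rewrite x0 expr0n/= add0r => /esym/eqP.
      by rewrite oner_eq0.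
    have xV : x^-1 = x - 1.
      by apply: (mulfI x0); rewrite divff// mulrBr -expr2 hx; ring.
    have -> : x ^ (- n.+1%:Z) = x^-1 * x ^ (- n%:Z).
      by rewrite -!exprz_inv exprSz.
    rewrite -mulrA (IH x hx) xV rmorphB /=.
    have -> : (x - 1) * (a%:~R + b%:~R * x) =
      a%:~R * x - a%:~R + b%:~R * x ^+ 2 - b%:~R * x by ring.
    by rewrite hx; ring.
have b0 : b = 0.
  apply: (@golden_irrational _ t a b N) => //.
  by rewrite -hab// -hN.
rewrite hab ?b0 ?mulr0z ?mul0r ?addr0.
  by rewrite hN hab// b0 mulr0z mul0r addr0.
by rewrite (_ : (1 - t) ^+ 2 = 1 - 2 * t + t ^+ 2); [rewrite ht|]; ring.
Qed.

(** The four bounds are sums of geometric series over extremal digit patterns,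
    e.g. [t = 1 + (1 - t) ^ 2 + (1 - t) ^ 4 + ...]; they are stable under the Horner
    step [v |-> c + (1 - t) * v], because the next digit is 0 when [c] is 1. *)
Lemma conj_value_bounds {R : realFieldType} {t : R} (w : seq bool) :
  t ^+ 2 = t + 1 -> 1 < t -> sparse w ->
  if head false w then t - 1 < word_value (1 - t) w < t
  else -1 < word_value (1 - t) w < t - 1.
Proof.
move=> ht t1; have t2 := golden_lt2 ht t1; rewrite expr2 in ht.
rewrite /sparse; elim: w => [|c w IH] /=; first by move=> _; lra.
move=> cw; have := IH (path_sorted cw).
case: w {IH} cw => [|e w] /=; first by rewrite mulr0; case: c => _ /=; lra.
move: (e%:R + _) => v.
case/andP=> + _ hv.
have lo : -1 < v by case: e hv => /= hv; case/andP: hv => ? ?; lra.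
have hi : v < t by case: e hv {lo} => /= hv; case/andP: hv => ? ?; lra.
have lo' : 0 < (t - 1) * (v + 1) by rewrite mulr_gt0; lra.
case: c => /= ce; last first.
  have : 0 < (t - 1) * (t - v) by rewrite mulr_gt0; lra.
  by move=> ?; apply/andP; split; lra.
have : 0 < (t - 1) * (t - 1 - v).
  by move: hv ce; case: e => //= /andP[? ?] _; rewrite mulr_gt0; lra.
by move=> ?; apply/andP; split; lra.
Qed.

(** The tail starting at the second digit 1 has positive conjugate value, by
    [conj_value_bounds]; it is multiplied by [(1 - t) ^ s.+1], whose sign is that
    of [(- 1) ^ s.+1]. *)
Lemma conj_value_first_gap {R : realFieldType} {t : R} (s : nat) (w : seq bool) :
  t ^+ 2 = t + 1 -> 1 < t -> sparse (true :: nseq s false ++ true :: w) ->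
  let v := word_value (1 - t) (true :: nseq s false ++ true :: w) in
  if odd s then 1 < v else v < 1.
Proof.
move=> ht t1 hw /=.
have hw' : sparse (true :: w).
  by move: hw; rewrite /sparse /= cat_path /= => /and3P[].
have := conj_value_bounds (true :: w) ht t1 hw' => /= /andP[lo _].
have -> : word_value (1 - t) (nseq s false ++ true :: w) =
    (1 - t) ^+ s * word_value (1 - t) (true :: w).
  elim: s {hw} => [|s IH] /=; first by rewrite expr0 mul1r.
  by rewrite IH add0r exprS -mulrA.
rewrite mulrA -exprS.
have pos : 0 < (t - 1) ^+ s.+1 * word_value (1 - t) (true :: w).
  by rewrite mulr_gt0 ?exprn_gt0 /=; lra.
have -> : 1 - t = - (t - 1) by ring.
rewrite [X in _ + X * _]exprNn -signr_odd /= -mulrA.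
rewrite (_ : - (t - 1) = 1 - t); last by ring.
by case: (odd s) pos => /= pos; rewrite ?expr0 ?expr1; lra.
Qed.

(** * Words of digits of Bergman expansions *)

Lemma prefix_one_zeros_one (s s0 : nat) (w : seq bool) :
  prefix (one_zeros_one s) (true :: nseq s0 false ++ true :: w) = (s == s0).
Proof.
rewrite /one_zeros_one /=.
by elim: s s0 => [|s IH] [|s0] //=; rewrite ?prefix0s // IH.
Qed.

Lemma rev_one_zeros_one (s : nat) : rev (one_zeros_one s) = one_zeros_one s.
Proof. by rewrite /one_zeros_one rev_cons rev_rcons rev_nseq. Qed.

Lemma bit_wordP (w : seq bool) :
  w = nseq (size w) false \/ exists s w', w = nseq s false ++ true :: w'.
Proof.
elim: w => [|[] w IH]; first by left.
  by right; exists 0%N, w.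
case: IH => [{1}->|[s [w' ->]]]; first by left.
by right; exists s.+1, w'.
Qed.

Definition low_word (d : int -> bool) (r : int) (n : nat) : seq bool :=
  [seq d (r + k%:Z) | k <- iota 0 n].

Lemma low_wordS d r n : low_word d r n.+1 = d r :: low_word d (r + 1) n.
Proof.
rewrite /low_word /= addr0; congr cons.
rewrite -[1%N]addn0 iotaDl -map_comp; apply: eq_map => k /=.
by congr d; lia.
Qed.

Lemma sparse_low_word d r n :
  (forall i : int, ~~ (d (i + 1) && d i)) -> sparse (low_word d r n).
Proof.
move=> hd; elim: n r => // n IH r; rewrite low_wordS.
case: n IH => // n /(_ (r + 1)); rewrite low_wordS /sparse /= => ->.
by rewrite [d r && _]andbC hd.
Qed.

Lemma digit_word_rev (d : int -> bool) (l r : int) : r <= l ->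
  digit_word d l r = rev (low_word d r `|l - r|%N.+1).
Proof.
move=> hlr; apply: (@eq_from_nth _ false).
  by rewrite size_rev !size_map !size_iota.
move=> i; rewrite size_map size_iota => hi.
rewrite nth_rev ?size_map ?size_iota//.
rewrite !(nth_map 0%N) ?size_iota ?nth_iota//; try lia.
by congr d; lia.
Qed.

Lemma bergman_word_value (R : realType) (N : nat) (d : int -> bool) (l r : int) :
  is_bergman R N d -> is_largest_index d l -> is_smallest_index d r ->
  N%:R = phi R ^ r * word_value (phi R) (low_word d r `|l - r|%N.+1).
Proof.
move=> [_ _ ->] [dl hl] [dr hr].
have rl : r <= l by exact: hr.
rewrite (fsbigE [seq r + k%:Z | k <- iota 0 `|l - r|%N.+1]) //; first last.
- move=> i _; apply: contraNeq.
  rewrite mulf_eq0 negb_or pnatr_eq0 eqb0 negbK => /andP[di _].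
  apply/mapP; exists `|i - r|%N; last by have := hr _ di; lia.
  by rewrite mem_iota; have := hr _ di; have := hl _ di; lia.
- by rewrite map_inj_uniq ?iota_uniq// => i j /addrI[].
rewrite big_map.
have p0 : phi R != 0.
  by rewrite /phi mulf_neq0 ?invr_neq0// gt_eqF// ltr_wpDr// sqrtr_ge0.
rewrite (eq_bigl xpredT); last by move=> i; apply/mem_set.
move: (`|l - r|%N.+1) => n; elim: n {dr hr rl} r => [|n IH] r.
  by rewrite big_nil mulr0.
rewrite low_wordS /= big_cons addr0 -[1%N]addn0 iotaDl big_map.
under eq_bigr do rewrite PoszD addrA.
by rewrite IH expfzDr// expr1z; ring.
Qed.

(** * Location of an integer from its lowest digits *)

(** A factor [(1 - t) ^ r] with [r >= 0] would give [N < 2]; with [r = - m] it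
    equals [(- t) ^ m], so [m] odd would give [N < 0]. *)
Lemma bergman_order {R : realFieldType} {t : R} (N : nat) (r : int) (v : R) :
  t ^+ 2 = t + 1 -> 1 < t -> (2 <= N)%N -> t - 1 < v < t ->
  N%:R = (1 - t) ^ r * v ->
  exists p : nat, - r = (2 * p + 2)%N%:Z /\ N%:R = t ^+ (2 * p).+2 * v.
Proof.
move=> ht t1 N2 /andP[v_lo v_hi] hN; have t2 := golden_lt2 ht t1.
have N2' : 2 <= N%:R :> R by rewrite ler_nat.
have v0 : 0 < v by lra.
have conjV : (1 - t)^-1 = - t.
  have h : (1 - t) * - t = 1.
    by rewrite (_ : _ * _ = t ^+ 2 - t); [rewrite ht|]; ring.
  have t0 : 1 - t != 0 by rewrite lt_eqF//; lra.
  by apply: (mulfI t0); rewrite divff// h.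
have [m rm] : exists m : nat, r = - m%:Z.
  case: (lerP r 0) => [r0|r0]; first by exists `|r|%N; lia.
  have [k rk] : exists k : nat, r = k%:Z by exists `|r|%N; lia.
  have : `|(1 - t) ^+ k| <= 1.
    by rewrite normrX exprn_ile1// ler_norml; lra.
  move: hN; rewrite rk -exprnP ler_norml => hN /andP[_ hk].
  have : (1 - t) ^+ k * v <= 1 * v by rewrite ler_pM2r.
  lra.
move: hN; rewrite rm -exprz_inv conjV -exprnP exprNn -signr_odd => hN.
have tm : 0 < t ^+ m by rewrite exprn_gt0; lra.
have m_even : ~~ odd m.
  apply/negP => om; move: hN; rewrite om expr1 mulN1r mulNr => hN.
  have : 0 < t ^+ m * v by rewrite mulr_gt0.
  lra.
move: hN; rewrite (negbTE m_even) expr0 mul1r => hN.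
have m0 : (0 < m)%N by case: m hN {rm tm m_even} => // hN; move: hN; rewrite expr0; lra.
have mE : m = (2 * (m.-2)./2).+2 by have := odd_double_half m; lia.
exists (m.-2)./2; rewrite -mE; split=> //; lia.
Qed.

(** A single digit 1 is impossible: it would give [N = t ^ r < 1].  So a second
    one exists, its distance to the lowest determines [s], and it decides
    between the two possible Lucas intervals. *)
Lemma bergman_gap (R : realType) (N : nat) (d : int -> bool) (l r : int) :
  (2 <= N)%N -> is_bergman R N d -> is_largest_index d l ->
  is_smallest_index d r ->
  exists p s : nat,
    [/\ - r = (2 * p + 2)%N%:Z,
        forall s', suffix (one_zeros_one s') (digit_word d l r) = (s' == s)
      & if odd s then (lucas (2 * p).+2 <= N <= lucas (2 * p).+3)%N
        else (lucas (2 * p).+1 < N < lucas (2 * p).+2)%N].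
Proof.
move=> N2 hd hl hr.
have ht := phi_sqr R; have t1 := phi_gt1 R; have t2 := golden_lt2 ht t1.
have rl : r <= l by case: hr => + _; exact: hl.2.
have hN := bergman_word_value R N d l r hd hl hr.
have hN' := word_value_galois N r _ ht hN.
have dw := digit_word_rev d l r rl.
have hsp : sparse (low_word d r `|l - r|%N.+1).
  by apply: sparse_low_word; case: hd.
move: hN hN' dw hsp; rewrite low_wordS (proj1 hr).
set w := low_word _ _ _ => hN hN' dw hsp.
have /= hv := conj_value_bounds _ ht t1 hsp.
have [p [rp hNp]] := bergman_order N r _ ht t1 N2 hv hN'.
case: (bit_wordP w) => [w0|[s [w' wE]]].
  have w0v x : word_value x w = 0.
    by rewrite w0; elim: (size w) => //= n ->; rewrite add0r mulr0.
  move: hN; rewrite /= w0v mulr0 addr0 mulr1 -[r]opprK rp => hN.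
  have : (phi R)^-1 ^ (2 * p + 2)%N <= 1.
    by rewrite -exprnP exprn_ile1// ?invr_ge0 ?invf_le1; lra.
  rewrite exprz_inv -hN.
  have : 2 <= N%:R :> R by rewrite ler_nat.
  lra.
exists p, s; split=> //.
  move=> s'; rewrite dw wE -prefix_rev revK rev_one_zeros_one.
  exact: prefix_one_zeros_one.
have /= := conj_value_first_gap s w' ht t1; rewrite -wE => /(_ hsp).
move: hv hNp; set v := _ + _ => /andP[v_lo v_hi] hNp.
have tm : 0 < phi R ^+ (2 * p).+2 by rewrite exprn_gt0; lra.
have lo : phi R ^+ (2 * p).+1 < N%:R.
  have : phi R ^+ (2 * p).+2 * (phi R - 1) < N%:R by rewrite hNp ltr_pM2l.
  by rewrite [phi R ^+ _.+2]exprSr -mulrA mulrBr -expr2 ht mulr1 addrC addKr mulr1.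
have hi : N%:R < phi R ^+ (2 * p).+3 by rewrite hNp [X in _ < X]exprSr ltr_pM2l.
case: (odd s) => v1.
  have e : (2 * p).+3 = (2 * p.+1).+1 by lia.
  apply/andP; split.
    by apply: (lucas_even_bounds p N ht t1).1; rewrite hNp ltr_pMr.
  by rewrite e; apply: (lucas_odd_bounds p.+1 N ht t1).2; rewrite -e.
apply/andP; split; first exact: (lucas_odd_bounds p N ht t1).1.
by apply: (lucas_even_bounds p N ht t1).2; rewrite hNp gtr_pMr.
Qed.

Theorem proposition5p1 (R : realType) (N : nat) (hN : (2 <= N)%N)
    (beta : int -> bool) (hbeta : is_bergman R N beta)
    (l r : int) (hl : is_largest_index beta l)
    (hr : is_smallest_index beta r) :
  (* (a) *)
  (((exists n : nat, N \in even_lucas_interval n) <->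
    (exists s : nat, odd s /\ suffix (one_zeros_one s) (digit_word beta l r)))
   /\
   ((exists n : nat, N \in odd_lucas_interval n) <->
    (exists s : nat, ~~ odd s /\ suffix (one_zeros_one s) (digit_word beta l r))))
  /\
  (* (b) *)
  (forall n : nat,
    (N \in even_lucas_interval n -> - r = (2 * n)%N%:Z) /\
    (N \in odd_lucas_interval n -> - r = (2 * n + 2)%N%:Z)).
Proof.
have [p [s [rp hs hgap]]] := bergman_gap R N beta l r hN hbeta hl hr.
have hNp : (lucas (2 * p).+1 < N <= lucas (2 * p).+3)%N.
  have := ltn_lucasS (2 * p).+1 isT; have := ltn_lucasS (2 * p).+2 isT.
  by case: (odd s) hgap => /andP[? ?] ? ?; lia.
have evenE n := even_lucas_intervalE p n N hNp.
have oddE n := odd_lucas_intervalE p n N hNp.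
have gap_even : (lucas (2 * p).+2 <= N)%N = odd s.
  case: (odd s) hgap => /andP[lo hi]; first by rewrite lo.
  by rewrite leqNgt hi.
split; first split; last 1 first.
- move=> n; rewrite evenE oddE; split=> /andP[/eqP-> _]; rewrite rp; lia.
- split=> [[n]|[s' []]]; first by rewrite evenE gap_even => /andP[_ ?]; exists s; rewrite hs eqxx.
  by rewrite hs => + /eqP ss; rewrite ss => os; exists p.+1; rewrite evenE gap_even eqxx.
- split=> [[n]|[s' []]].
    by rewrite oddE ltnNge gap_even => /andP[_ ?]; exists s; rewrite hs eqxx.
  by rewrite hs => + /eqP ss; rewrite ss => os; exists p; rewrite oddE ltnNge gap_even eqxx.
Qed.
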